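(* Let $q$ be a nonzero complex number with $|q|<1$, and let $a,b$ be complex numbers with $b\neq 0$ and $\left|\frac{q^2}{b}\right|<1$. Fix square roots $a^{1/2}$ of $a$ and $q^{1/2}$ of $q$, and write $a^{1/2}q^{k/2}=a^{1/2}(q^{1/2})^k$ for integers $k$. Assume that none of the denominators in the series below vanishes, i.e. none of $a^{1/2},\,-a^{1/2},\,a^{1/2}q^{3/2},\,-a^{1/2}q^{3/2},\,aq/b$ is of the form $q^{-k}$ with $k\geq 0$ an integer. Then $${}_6\phi_5\!\left[\begin{matrix}a,\; a^{\frac12}q,\; -a^{\frac12}q,\; a^{\frac12}q^{-\frac12},\; -a^{\frac12}q^{-\frac12},\; b\\ a^{\frac12},\; -a^{\frac12},\; a^{\frac12}q^{\frac32},\; -a^{\frac12}q^{\frac32},\; aq/b\end{matrix};q,-\frac{q^2}{b}\right] =(1-aq)\,\frac{(-q^2;q)_\infty}{(-q^2/b;q)_\infty\,(aq/b;q)_\infty}\,(aq^2;q^2)_\infty\,(aq^3/b^2;q^2)_\infty .$$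
   Context: For a complex number $p$ with $|p|<1$ and complex $x$: $(x;p)_0=1$, $(x;p)_n=\prod_{k=0}^{n-1}(1-xp^k)$ for $n\ge1$, and $(x;p)_\infty=\prod_{k=0}^{\infty}(1-xp^k)$ (used with $p=q$ and $p=q^2$). The basic hypergeometric series is $${}_r\phi_{r-1}\!\left[\begin{matrix}a_1,\dots,a_r\\ b_1,\dots,b_{r-1}\end{matrix};q,x\right]=\sum_{n=0}^{\infty}\frac{(a_1;q)_n\cdots(a_r;q)_n}{(q;q)_n(b_1;q)_n\cdots(b_{r-1};q)_n}x^n .$$ *)

(* Defs.v *)
From Stdlib Require Import Reals List.
From Coquelicot Require Import Coquelicot.
Import ListNotations.
Open Scope C_scope.

Fixpoint qpoch (x p : C) (n : nat) : C :=
  match n with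
  | O => 1
  | S m => qpoch x p m * (1 - x * p ^ m)
  end.

(* Componentwise limit of a complex sequence; it is the usual limit whenever
   the sequence converges, and unspecified otherwise. *)
Definition CLim_seq (u : nat -> C) : C :=
  (real (Lim_seq (fun n => Re (u n))), real (Lim_seq (fun n => Im (u n)))).

(* Meaningful for [Cmod p < 1], where the partial products converge. *)
Definition qpoch_inf (x p : C) : C := CLim_seq (qpoch x p).

Definition qpochs (l : list C) (p : C) (n : nat) : C :=
  fold_right Cmult 1 (map (fun x => qpoch x p n) l).

(* General term of the series r-phi-(r-1) with upper parameters [a] and lower
   parameters [b]; intended for [length a = S (length b)], the case in which
   the power of (-1)^n q^(n(n-1)/2) in the general r-phi-s term is trivial. *)
Definition phi_term (a b : list C) (q x : C) (n : nat) : C :=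
  qpochs a q n / (qpoch q q n * qpochs b q n) * x ^ n.

Definition is_phi (a b : list C) (q x s : C) : Prop :=
  is_series (K := C_AbsRing) (V := C_NormedModule) (phi_term a b q x) s.

(* Main.v *)
Require Import Defs.
From Stdlib Require Import Reals List Lra Lia.
From Coquelicot Require Import Coquelicot.
Import ListNotations.
Open Scope C_scope.

(** Write (x)_n for (x;q)_n and z = -q^2/b.  The parameters of the series come
    in pairs c, -c, and (c)_n (-c)_n = (c^2;q^2)_n, so the square roots
    disappear and the sum is a function S(a) of a alone, with b and q fixed.

    The right-hand side changes by an explicit rational factor when a is
    replaced by a q^2, and so does S:
      (1-aq^3)(1-aq/b)(1-aq^2/b) S(a) = (1-aq)(1-aq^2)(1-aq^3/b^2) S(aq^2).
    This contiguous relation ([vwp_rec]) telescopes: the partial sums of the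
    difference of its two sides have a closed form ([cert_sum]), which tends
    to 0.  Iterating it N times ([vwp_iter]) expresses S(a) by finite products
    and S(a q^(2N)).  As N grows, the products become the infinite products
    of the theorem.  The terms of S(a q^(2N)) converge to those of
    the sum of (b)_n/(q)_n z^n, and Tannery's theorem ([tannery]) lets the
    limit pass through the sum, because the ratio of consecutive terms tends
    to z uniformly in N ([vwp_dominated]).  The limiting series is summed by
    the q-binomial theorem ([qbinom_theorem]).

    The q-binomial theorem has the same proof in miniature: with f(z) the sum
    of (b)_n/(p)_n z^n, the relation (1-z) f(z) = (1-bz) f(pz) telescopes, and
    iterating it gives (z)_N f(z) = (bz)_N f(z p^N) with f(z p^N) -> 1.  The
    case b = 0 shows in addition that (z;p)_N has a nonzero limit 1/f(z) for
    |z| < 1, from which the convergence of all infinite products and their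
    nonvanishing follow ([qpoch_inf_lim], [qpoch_inf_neq_0]). *)

(** * Limits of complex-valued functions along a filter *)

(** Stated with [Cmod] because [C] carries two uniform structures, the product
    one and the one of its absolute value; the filter is arbitrary so that
    limits of sequences and limits uniform in a parameter share one theory. *)
Definition clim {T : Type} (F : (T -> Prop) -> Prop) (f : T -> C) (l : C) :=
  forall eps : R, (0 < eps)%R -> F (fun t => (Cmod (f t - l) < eps)%R).

Lemma clim_filterlim {T : Type} {F : (T -> Prop) -> Prop} {FF : Filter F}
  (f : T -> C) (l : C) :
  clim F f l <-> filterlim f F (locally (T := C_UniformSpace) l).
Proof.
split.
- intros H.
  apply (proj2 (filterlim_locally_ball_norm (K := C_AbsRing)
                  (U := C_NormedModule) f l)).
  intros eps; exact (H eps (cond_pos eps)).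
- intros H eps heps.
  exact (proj1 (filterlim_locally_ball_norm (K := C_AbsRing)
                  (U := C_NormedModule) f l) H (mkposreal eps heps)).
Qed.

Section Limits.

Context {T : Type} {F : (T -> Prop) -> Prop} {FF : Filter F}.

Lemma clim_ext (f g : T -> C) (l : C) :
  (forall t, f t = g t) -> clim F f l -> clim F g l.
Proof.
intros e H eps heps; generalize (H eps heps); apply filter_imp.
intros t; now rewrite e.
Qed.

Lemma clim_eq (f : T -> C) (l l' : C) : l = l' -> clim F f l -> clim F f l'.
Proof. now intros ->. Qed.

Lemma clim_const (c : C) : clim F (fun _ => c) c.
Proof.
intros eps heps; apply filter_forall; intros _.
replace (c - c) with (RtoC 0) by ring; now rewrite Cmod_0.
Qed.

Lemma clim_plus (f g : T -> C) (a b : C) :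
  clim F f a -> clim F g b -> clim F (fun t => f t + g t) (a + b).
Proof.
intros Hf Hg eps heps.
assert (h : (0 < eps / 2)%R) by lra.
generalize (filter_and _ _ (Hf _ h) (Hg _ h)); apply filter_imp.
intros t [h1 h2].
replace (f t + g t - (a + b)) with ((f t - a) + (g t - b)) by ring.
apply Rle_lt_trans with (1 := Cmod_triangle _ _); lra.
Qed.

Lemma clim_mult (f g : T -> C) (a b : C) :
  clim F f a -> clim F g b -> clim F (fun t => f t * g t) (a * b).
Proof.
intros Hf Hg eps heps.
set (M := (1 + Cmod a + Cmod b)%R).
assert (hM : (1 <= M)%R).
{ unfold M; generalize (Cmod_ge_0 a) (Cmod_ge_0 b); lra. }
set (d := Rmin 1 (eps / M)).
assert (hd : (0 < d)%R).
{ apply Rmin_pos; [lra | apply Rdiv_lt_0_compat; lra]. }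
assert (hdM : (d * M <= eps)%R).
{ apply Rle_trans with (eps / M * M)%R.
  - apply Rmult_le_compat_r; [lra | apply Rmin_r].
  - right; field; lra. }
assert (hd1 : (d <= 1)%R) by apply Rmin_l.
generalize (filter_and _ _ (Hf _ hd) (Hg _ hd)); apply filter_imp.
intros t [h1 h2].
replace (f t * g t - a * b)
  with ((f t - a) * (g t - b) + (a * (g t - b) + b * (f t - a))) by ring.
apply Rle_lt_trans with (1 := Cmod_triangle _ _).
apply Rle_lt_trans
  with (Cmod (f t - a) * Cmod (g t - b)
        + (Cmod a * Cmod (g t - b) + Cmod b * Cmod (f t - a)))%R.
{ rewrite Cmod_mult; apply Rplus_le_compat_l.
  apply Rle_trans with (1 := Cmod_triangle _ _).
  rewrite 2!Cmod_mult; lra. }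
apply Rlt_le_trans with (2 := hdM).
unfold M.
generalize (Cmod_ge_0 (f t - a)) (Cmod_ge_0 (g t - b))
  (Cmod_ge_0 a) (Cmod_ge_0 b).
nra.
Qed.

Lemma clim_inv (f : T -> C) (a : C) :
  a <> 0 -> clim F f a -> clim F (fun t => / f t) (/ a).
Proof.
intros ha Hf eps heps.
assert (hA := proj1 (Cmod_gt_0 a) ha).
set (A := Cmod a) in *.
set (d := Rmin (A / 2) (eps * (A * A) / 2)).
assert (hd : (0 < d)%R).
{ apply Rmin_pos; [lra | ].
  apply Rdiv_lt_0_compat; [ | lra].
  apply Rmult_lt_0_compat; [lra | nra]. }
generalize (Hf _ hd); apply filter_imp; intros t ht.
assert (h1 : (Cmod (f t - a) < A / 2)%R)
  by (apply Rlt_le_trans with (1 := ht); apply Rmin_l).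
assert (h2 : (Cmod (f t - a) < eps * (A * A) / 2)%R)
  by (apply Rlt_le_trans with (1 := ht); apply Rmin_r).
assert (h3 : (A / 2 < Cmod (f t))%R).
{ assert (e : (A <= Cmod (f t) + Cmod (f t - a))%R).
  { unfold A; replace a with (f t + - (f t - a)) at 1 by ring.
    apply Rle_trans with (1 := Cmod_triangle _ _).
    rewrite Cmod_opp; lra. }
  lra. }
assert (hf : f t <> 0) by (apply Cmod_gt_0; lra).
replace (/ f t - / a) with (- (f t - a) * / (f t * a)) by (field; auto).
rewrite Cmod_mult, Cmod_opp, Cmod_inv, Cmod_mult by (apply Cmult_neq_0; auto).
fold A.
assert (h4 : (0 < Cmod (f t) * A)%R) by (apply Rmult_lt_0_compat; lra).
apply (Rmult_lt_reg_r (Cmod (f t) * A)); [exact h4 | ].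
rewrite Rmult_assoc, Rinv_l, Rmult_1_r by lra.
apply Rlt_trans with (1 := h2).
replace (eps * (A * A) / 2)%R with (eps * ((A / 2) * A))%R by field.
apply Rmult_lt_compat_l; [lra | ].
apply Rmult_lt_compat_r; lra.
Qed.

Lemma clim_pow (f : T -> C) (l : C) (n : nat) :
  clim F f l -> clim F (fun t => f t ^ n) (l ^ n).
Proof.
intros H; induction n as [ | n IH].
- exact (clim_const 1).
- exact (clim_mult _ _ _ _ H IH).
Qed.

Lemma clim_1_minus (f : T -> C) : clim F f 0 -> clim F (fun t => 1 - f t) 1.
Proof.
intros H.
apply (clim_ext (fun t => 1 + (-1) * f t)); [intros t; ring | ].
apply (clim_eq _ (1 + (-1) * 0)); [ring | ].
apply clim_plus; [apply clim_const | ].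
apply clim_mult; [apply clim_const | exact H].
Qed.

Lemma clim_0_bound (f : T -> C) (g : T -> R) :
  (forall t, (Cmod (f t) <= g t)%R) ->
  (forall eps, (0 < eps)%R -> F (fun t => (g t < eps)%R)) -> clim F f 0.
Proof.
intros hfg hg eps heps; generalize (hg eps heps); apply filter_imp.
intros t ht; replace (f t - 0) with (f t) by ring.
apply Rle_lt_trans with (2 := ht); auto.
Qed.

Lemma clim_scal_0 (c : C) (f : T -> C) :
  clim F f 0 -> clim F (fun t => c * f t) 0.
Proof.
intros H; apply (clim_eq _ (c * 0)); [ring | ].
apply clim_mult; [apply clim_const | exact H].
Qed.

End Limits.

Lemma clim_closed_ball (f : nat -> C) (l c : C) (B : R) (n0 : nat) :
  clim eventually f l ->
  (forall n, (n0 <= n)%nat -> (Cmod (f n - c) <= B)%R) -> (Cmod (l - c) <= B)%R.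
Proof.
intros H hB; apply Rnot_lt_le; intros hlt.
destruct (H (Cmod (l - c) - B)%R) as [n1 h1]; [lra | ].
specialize (h1 (max n0 n1) (Nat.le_max_r _ _)).
specialize (hB (max n0 n1) (Nat.le_max_l _ _)).
set (y := f (max n0 n1)) in *.
assert (h : (Cmod (l - c) <= Cmod (y - l) + Cmod (y - c))%R).
{ replace (l - c) with (- (y - l) + (y - c)) by ring.
  apply Rle_trans with (1 := Cmod_triangle _ _); rewrite Cmod_opp; lra. }
lra.
Qed.

Lemma clim_unique (f : nat -> C) (a b : C) :
  clim eventually f a -> clim eventually f b -> a = b.
Proof.
intros Ha Hb.
apply clim_filterlim in Ha; apply clim_filterlim in Hb.
exact (filterlim_locally_unique (K := C_AbsRing) (V := C_NormedModule)
         f a b Ha Hb).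
Qed.

Lemma clim_bounded (f : nat -> C) (l : C) :
  clim eventually f l -> exists M, forall n, (Cmod (f n) <= M)%R.
Proof.
intros H; apply clim_filterlim in H.
destruct (filterlim_bounded (K := C_AbsRing) (V := C_NormedModule) f)
  as [M hM]; [now exists l | ].
now exists M.
Qed.

Lemma CLim_seq_eq (u : nat -> C) (l : C) :
  clim eventually u l -> CLim_seq u = l.
Proof.
intros h.
assert (hR : forall f : C -> R, (forall c d, f c - f d = f (c - d)%C)%R ->
  (forall c, Rabs (f c) <= Cmod c)%R -> is_lim_seq (fun n => f (u n)) (f l)).
{ intros f hf hb; apply is_lim_seq_spec; intros eps.
  generalize (h eps (cond_pos eps)); apply filter_imp; intros n hn.
  rewrite hf; apply Rle_lt_trans with (2 := hn), hb. }
assert (hRe := hR Re (fun _ _ => eq_refl)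
  (fun c => Rle_trans _ _ _ (Rmax_l _ _) (Rmax_Cmod c))).
assert (hIm := hR Im (fun _ _ => eq_refl)
  (fun c => Rle_trans _ _ _ (Rmax_r _ _) (Rmax_Cmod c))).
unfold CLim_seq; rewrite (is_lim_seq_unique _ _ hRe).
rewrite (is_lim_seq_unique _ _ hIm); symmetry; apply surjective_pairing.
Qed.

Lemma clim_subseq (f : nat -> C) (l : C) (g : nat -> nat) :
  (forall n, (n <= g n)%nat) ->
  clim eventually f l -> clim eventually (fun n => f (g n)) l.
Proof.
intros hg H eps heps; destruct (H eps heps) as [n0 h0].
exists n0; intros n hn; apply h0; specialize (hg n); lia.
Qed.

Lemma clim_incr_n (f : nat -> C) (l : C) (k : nat) :
  clim eventually (fun n => f (k + n)%nat) l -> clim eventually f l.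
Proof.
intros H eps heps; destruct (H eps heps) as [n0 h0].
exists (k + n0)%nat; intros n hn.
replace n with (k + (n - k))%nat by lia; apply h0; lia.
Qed.

Lemma pow_small (K r : R) : (0 <= K)%R -> (0 <= r < 1)%R ->
  forall eps, (0 < eps)%R -> eventually (fun n => (K * r ^ n < eps)%R).
Proof.
intros hK hr eps heps.
assert (h : is_lim_seq (fun n => (K * r ^ n)%R) (K * 0)%R).
{ apply (is_lim_seq_mult' (fun _ => K) (fun n => (r ^ n)%R));
    [apply is_lim_seq_const | apply is_lim_seq_geom; rewrite Rabs_pos_eq; lra]. }
rewrite Rmult_0_r in h.
apply is_lim_seq_spec in h.
destruct (h (mkposreal eps heps)) as [n0 h0]; exists n0; intros n hn.
specialize (h0 n hn); simpl in h0; rewrite Rminus_0_r in h0.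
apply Rle_lt_trans with (2 := h0), Rle_abs.
Qed.

Lemma clim_geom (c p : C) : (Cmod p < 1)%R ->
  clim eventually (fun n => c * p ^ n) 0.
Proof.
intros hp; apply (clim_0_bound _ (fun n => (Cmod c * Cmod p ^ n)%R)).
- intros n; rewrite Cmod_mult, Cmod_pow; lra.
- apply pow_small; [apply Cmod_ge_0 | split; [apply Cmod_ge_0 | exact hp]].
Qed.

(** * Uniform limits and dominated series *)

(** A function of (N, n) converges along this filter when it converges as
    [n] tends to infinity, uniformly in [N]. *)
Definition uniformly (P : nat * nat -> Prop) :=
  exists n0, forall N n, (n0 <= n)%nat -> P (N, n).

Global Instance uniformly_filter : Filter uniformly.
Proof.
split.
- now exists 0%nat.
- intros P Q [n1 h1] [n2 h2]; exists (max n1 n2); intros N n hn.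
  split; [apply h1 | apply h2]; lia.
- intros P Q h [n1 h1]; exists n1; intros N n hn; apply h, h1, hn.
Qed.

Lemma clim_uniformly_geom (f : nat * nat -> C) (K r : R) :
  (0 <= K)%R -> (0 <= r < 1)%R ->
  (forall N n, (Cmod (f (N, n)) <= K * r ^ n)%R) -> clim uniformly f 0.
Proof.
intros hK hr h; apply (clim_0_bound _ (fun t => (K * r ^ snd t)%R)).
- now intros [N n].
- intros eps heps; destruct (pow_small K r hK hr eps heps) as [n0 h0].
  exists n0; intros N n hn; exact (h0 n hn).
Qed.

Definition geom_dominated (u : nat -> nat -> C) :=
  exists K r, (0 <= K)%R /\ (0 < r < 1)%R /\
    forall N n, (Cmod (u N n) <= K * r ^ n)%R.

(** The ratio test, uniformly in [N].  Beyond some rank independent of [N] the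
    ratios have modulus at most (1+|z|)/2; the finitely many columns before
    that rank are bounded because each of them converges. *)
Lemma ratio_geom_dominated (u : nat -> nat -> C) (v : nat -> C)
  (w : nat * nat -> C) (z : C) :
  (Cmod z < 1)%R -> clim uniformly w z ->
  (forall N n, u N (S n) = w (N, n) * u N n) ->
  (forall n, clim eventually (fun N => u N n) (v n)) ->
  geom_dominated u.
Proof.
intros hz hw hu hv.
set (r := ((1 + Cmod z) / 2)%R).
assert (hr : (0 < r < 1)%R) by (unfold r; generalize (Cmod_ge_0 z); lra).
destruct (hw (r - Cmod z)%R) as [n0 h0]; [unfold r; lra | ].
assert (hratio : forall N n, (n0 <= n)%nat ->
  (Cmod (u N (S n)) <= r * Cmod (u N n))%R).
{ intros N n hn; rewrite hu, Cmod_mult.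
  apply Rmult_le_compat_r; [apply Cmod_ge_0 | ].
  specialize (h0 N n hn).
  replace (w (N, n)) with ((w (N, n) - z) + z) by ring.
  apply Rle_trans with (1 := Cmod_triangle _ _); lra. }
assert (hK : exists K, (0 <= K)%R /\
  forall N n, (n <= n0)%nat -> (Cmod (u N n) <= K)%R).
{ clear h0 hratio; induction n0 as [ | m [K [hK IH]]].
  - destruct (clim_bounded _ _ (hv 0%nat)) as [M hM].
    exists M; split.
    + apply Rle_trans with (2 := hM 0%nat), Cmod_ge_0.
    + intros N n hn; replace n with 0%nat by lia; apply hM.
  - destruct (clim_bounded _ _ (hv (S m))) as [M hM].
    exists (Rmax K M); split.
    + apply Rle_trans with (1 := hK), Rmax_l.
    + intros N n hn; destruct (Nat.eq_dec n (S m)) as [-> | hne].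
      * apply Rle_trans with (1 := hM N), Rmax_r.
      * apply Rle_trans with (2 := Rmax_l _ _); apply IH; lia. }
destruct hK as [K [hK0 hK]].
assert (hrn : forall n, (0 < r ^ n)%R) by (intros n; apply pow_lt; lra).
exists (K / r ^ n0)%R, r; split; [ | split; [exact hr | ]].
{ apply Rdiv_le_0_compat; auto. }
intros N n; destruct (Nat.le_gt_cases n n0) as [hn | hn].
- apply Rle_trans with (1 := hK N n hn).
  replace n0 with (n + (n0 - n))%nat by lia.
  rewrite pow_add.
  replace (K / (r ^ n * r ^ (n0 - n)) * r ^ n)%R
    with (K * / (r ^ (n0 - n)))%R
    by (field; split; apply Rgt_not_eq, hrn).
  rewrite <- (Rmult_1_r K) at 1.
  apply Rmult_le_compat_l; [exact hK0 | ].
  rewrite <- Rinv_1; apply Rinv_le_contravar; [apply hrn | ].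
  rewrite <- (pow1 (n0 - n)); apply pow_incr; lra.
- replace n with (n0 + (n - n0))%nat by lia.
  generalize (n - n0)%nat as k; clear n hn.
  induction k as [ | k IH].
  + rewrite Nat.add_0_r.
    replace (K / r ^ n0 * r ^ n0)%R with K
      by (field; apply Rgt_not_eq, hrn).
    now apply hK.
  + rewrite Nat.add_succ_r.
    apply Rle_trans with (1 := hratio N (n0 + k)%nat ltac:(lia)).
    simpl; generalize IH; generalize (r ^ (n0 + k))%R; intros x hx.
    apply Rle_trans with (r * (K / r ^ n0 * x))%R; [ | right; ring].
    apply Rmult_le_compat_l; lra.
Qed.

Notation is_Cseries := (is_series (K := C_AbsRing) (V := C_NormedModule)).
Notation Csum := (sum_n (G := C_AbelianGroup)).

Lemma Csum_S (a : nat -> C) (n : nat) : Csum a (S n) = Csum a n + a (S n).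
Proof. exact (sum_Sn (G := C_AbelianGroup) a n). Qed.

Lemma is_Cseries_clim (a : nat -> C) (s : C) :
  is_Cseries a s <-> clim eventually (Csum a) s.
Proof. symmetry; exact (clim_filterlim (Csum a) s). Qed.

Lemma Csum_0 (a : nat -> C) : Csum a 0 = a 0%nat.
Proof. exact (sum_O (G := C_AbelianGroup) a). Qed.

Definition Cseries (a : nat -> C) : C := CLim_seq (Csum a).

Lemma geom_bound_Cseries (a : nat -> C) (K r : R) : (0 < r < 1)%R ->
  (forall n, (Cmod (a n) <= K * r ^ n)%R) -> is_Cseries a (Cseries a).
Proof.
intros hr ha.
cut (exists s, is_Cseries a s).
{ intros [s hs]; unfold Cseries.
  now rewrite (CLim_seq_eq _ s (proj1 (is_Cseries_clim a s) hs)). }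
apply (ex_series_le (K := C_AbsRing) (V := C_CompleteNormedModule) a
         (fun n => (K * r ^ n)%R) ha).
apply (ex_series_scal_l K (fun n => (r ^ n)%R)).
apply ex_series_geom; rewrite Rabs_pos_eq; lra.
Qed.

(** The geometric tail estimate that splits the error in Tannery's theorem. *)
Lemma geom_bound_tail (a : nat -> C) (s : C) (K r : R) :
  (0 <= K)%R -> (0 < r < 1)%R ->
  (forall n, (Cmod (a n) <= K * r ^ n)%R) -> is_Cseries a s ->
  forall m, (Cmod (s - Csum a m) <= K / (1 - r) * r ^ m)%R.
Proof.
intros hK hr ha hs m; apply is_Cseries_clim in hs.
apply (clim_closed_ball _ _ _ _ m hs).
intros n hn; replace n with (m + (n - m))%nat by lia.
generalize (n - m)%nat as k; clear n hn; intros k.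
apply Rle_trans with (K / (1 - r) * (r ^ m - r ^ (m + k)))%R.
- induction k as [ | k IH].
  + rewrite Nat.add_0_r.
    replace (Csum a m - Csum a m) with (RtoC 0) by ring.
    rewrite Cmod_0; right; ring.
  + rewrite Nat.add_succ_r, Csum_S.
    replace (Csum a (m + k) + a (S (m + k)) - Csum a m)
      with ((Csum a (m + k) - Csum a m) + a (S (m + k))) by ring.
    apply Rle_trans with (1 := Cmod_triangle _ _).
    apply Rle_trans with (1 := Rplus_le_compat _ _ _ _ IH (ha (S (m + k)))).
    simpl; generalize (pow_lt r (m + k) ltac:(lra)).
    generalize (r ^ (m + k))%R as x; intros x hx.
    assert (h : (0 <= K * x)%R) by nra.
    replace (K / (1 - r) * (r ^ m - x) + K * (r * x))%R
      with (K / (1 - r) * (r ^ m - r * x) - (1 - r) * (K * x))%R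
      by (field; lra).
    nra.
- assert (h : (0 <= K / (1 - r))%R) by (apply Rdiv_le_0_compat; lra).
  generalize (pow_lt r (m + k) ltac:(lra)); nra.
Qed.

(** Dominated convergence for series: a finite part converges termwise, and the
    two remainders are small by the geometric bound. *)
Lemma tannery (u : nat -> nat -> C) (v s : nat -> C) (l : C) :
  geom_dominated u ->
  (forall n, clim eventually (fun N => u N n) (v n)) ->
  (forall N, is_Cseries (u N) (s N)) -> is_Cseries v l ->
  clim eventually s l.
Proof.
intros [K [r [hK [hr hu]]]] huv hs hl eps heps.
assert (hv : forall n, (Cmod (v n) <= K * r ^ n)%R).
{ intros n; replace (v n) with (v n - 0) by ring.
  apply (clim_closed_ball _ _ _ _ 0 (huv n)); intros N _.
  replace (u N n - 0) with (u N n) by ring; apply hu. }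
assert (hK1 : (0 <= K / (1 - r))%R) by (apply Rdiv_le_0_compat; lra).
destruct (pow_small (K / (1 - r)) r hK1 ltac:(lra) (eps / 3) ltac:(lra))
  as [m hm].
specialize (hm m (Nat.le_refl m)).
assert (hpart : clim eventually (fun N => Csum (u N) m) (Csum v m)).
{ clear hm; induction m as [ | m IH].
  - apply (clim_ext (fun N => u N 0%nat)).
    + intros N; symmetry; apply Csum_0.
    + rewrite Csum_0; apply huv.
  - apply (clim_ext (fun N => Csum (u N) m + u N (S m))).
    + intros N; symmetry; apply Csum_S.
    + rewrite Csum_S; apply clim_plus; [exact IH | apply huv]. }
generalize (hpart (eps / 3)%R ltac:(lra)); apply filter_imp.
intros N hN.
generalize (geom_bound_tail _ _ K r hK hr (hu N) (hs N) m)
  (geom_bound_tail _ _ K r hK hr hv hl m).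
intros h1 h2.
replace (s N - l)
  with ((s N - Csum (u N) m) + ((Csum (u N) m - Csum v m)
        + - (l - Csum v m))) by ring.
apply Rle_lt_trans with (1 := Cmod_triangle _ _).
apply Rle_lt_trans
  with (1 := Rplus_le_compat_l _ _ _ (Cmod_triangle _ _)).
rewrite Cmod_opp; lra.
Qed.

(** How two-term relations between sums are obtained below: the combination
    of partial sums has a closed form [g] that tends to 0. *)
Lemma series_telescope (u v g : nat -> C) (s t a b : C) :
  is_Cseries u s -> is_Cseries v t -> clim eventually g 0 ->
  (forall m, a * Csum u m - b * Csum v m = g m) -> a * s = b * t.
Proof.
intros hs ht hg h.
apply is_Cseries_clim in hs; apply is_Cseries_clim in ht.
assert (e : a * s + - b * t = 0).
{ apply (clim_unique g); [ | exact hg].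
  apply (clim_ext (fun m => a * Csum u m + - b * Csum v m)).
  - intros m; rewrite <- h; ring.
  - apply clim_plus; apply clim_mult; auto; apply clim_const. }
replace (a * s) with ((a * s + - b * t) + b * t) by ring.
rewrite e; ring.
Qed.

Lemma geom_bound_clim_0 (a : nat -> C) (K r : R) : (0 < r < 1)%R ->
  (0 <= K)%R ->
  (forall n, (Cmod (a n) <= K * r ^ n)%R) -> clim eventually a 0.
Proof.
intros hr hK h; apply (clim_0_bound _ _ h); apply pow_small; lra.
Qed.

(** * Finite q-shifted factorials *)

Lemma qpoch_S (x p : C) (n : nat) :
  qpoch x p (S n) = qpoch x p n * (1 - x * p ^ n).
Proof. reflexivity. Qed.

Lemma qpoch_add (x p : C) (m n : nat) :
  qpoch x p (m + n) = qpoch x p m * qpoch (x * p ^ m) p n.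
Proof.
induction n as [ | n IH].
- rewrite Nat.add_0_r; simpl; ring.
- rewrite Nat.add_succ_r, 2!qpoch_S, IH, Cpow_add_r; ring.
Qed.

Lemma qpoch_S_l (x p : C) (n : nat) :
  qpoch x p (S n) = (1 - x) * qpoch (x * p) p n.
Proof.
change (S n) with (1 + n)%nat; rewrite qpoch_add, Cpow_1_r; simpl; ring.
Qed.

Lemma qpoch_neq_0 (x p : C) (n : nat) :
  (forall k, 1 - x * p ^ k <> 0) -> qpoch x p n <> 0.
Proof.
intros h; induction n as [ | n IH]; simpl; [exact C1_nz | ].
now apply Cmult_neq_0.
Qed.

Lemma qpoch_0_l (p : C) (n : nat) : qpoch 0 p n = 1.
Proof. induction n as [ | n IH]; simpl; [ | rewrite IH]; ring. Qed.

(** This removes the square roots from the series. *)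
Lemma qpoch_opp (x p : C) (n : nat) :
  qpoch x p n * qpoch (- x) p n = qpoch (x ^ 2) (p ^ 2) n.
Proof.
induction n as [ | n IH]; [simpl; ring | ].
rewrite 3!qpoch_S, <- IH, <- Cpow_mult_r, Nat.mul_comm, Cpow_mult_r; ring.
Qed.

Lemma clim_qpoch {T : Type} {F : (T -> Prop) -> Prop} {FF : Filter F}
  (x : T -> C) (p : C) (n : nat) :
  clim F x 0 -> clim F (fun t => qpoch (x t) p n) 1.
Proof.
intros H; induction n as [ | n IH]; simpl; [apply clim_const | ].
apply (clim_eq _ (1 * 1)); [ring | ].
apply clim_mult; [exact IH | ].
apply (clim_1_minus (fun t => x t * p ^ n)).
apply (clim_ext (fun t => p ^ n * x t)); [intros t; ring | ].
now apply clim_scal_0.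
Qed.

Lemma Cmod_lt_1_factor (x p : C) (k : nat) :
  (Cmod x < 1)%R -> (Cmod p <= 1)%R -> 1 - x * p ^ k <> 0.
Proof.
intros hx hp h.
assert (e : Cmod (x * p ^ k) = 1%R).
{ replace (x * p ^ k) with (1 - (1 - x * p ^ k)) by ring.
  rewrite h; replace (1 - 0) with (RtoC 1) by ring; apply Cmod_1. }
rewrite Cmod_mult, Cmod_pow in e.
assert (h1 : (Cmod p ^ k <= 1)%R).
{ rewrite <- (pow1 k); apply pow_incr; split; [apply Cmod_ge_0 | exact hp]. }
generalize (Cmod_ge_0 x) (pow_le _ k (Cmod_ge_0 p)); nra.
Qed.

(** * The q-binomial theorem and infinite products *)

Section Binomial.

Variable p : C.
Hypothesis hp : (Cmod p < 1)%R.

Let p_factor (k : nat) : 1 - p * p ^ k <> 0.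
Proof. apply Cmod_lt_1_factor; lra. Qed.

Definition qbinom_term (b z : C) (n : nat) : C :=
  qpoch b p n / qpoch p p n * z ^ n.

Lemma qbinom_term_S (b z : C) (n : nat) :
  qbinom_term b z (S n)
  = z * (1 - b * p ^ n) * / (1 - p * p ^ n) * qbinom_term b z n.
Proof.
unfold qbinom_term; rewrite 2!qpoch_S, Cpow_S; field.
split; [apply qpoch_neq_0, p_factor | apply p_factor].
Qed.

Lemma qbinom_term_dominated (b z : C) : (Cmod z < 1)%R ->
  geom_dominated (fun _ => qbinom_term b z).
Proof.
intros hz.
apply (ratio_geom_dominated _ (qbinom_term b z)
  (fun t => z * (1 - b * p ^ snd t) * / (1 - p * p ^ snd t)) z hz).
- assert (h : forall c, clim uniformly (fun t => 1 - c * p ^ snd t) 1).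
  { intros c; apply (clim_1_minus (fun t => c * p ^ snd t)).
    apply (clim_uniformly_geom _ (Cmod c) (Cmod p)).
    - apply Cmod_ge_0.
    - split; [apply Cmod_ge_0 | exact hp].
    - intros N n; simpl; rewrite Cmod_mult, Cmod_pow; lra. }
  apply (clim_eq _ (z * 1 * / 1)); [field; exact C1_nz | ].
  apply clim_mult; [apply clim_mult | apply clim_inv].
  + apply clim_const.
  + apply h.
  + exact C1_nz.
  + apply h.
- intros N n; simpl; apply qbinom_term_S.
- intros n; apply clim_const.
Qed.

Lemma qbinom_Cseries (b z : C) : (Cmod z < 1)%R ->
  is_Cseries (qbinom_term b z) (Cseries (qbinom_term b z)).
Proof.
intros hz; destruct (qbinom_term_dominated b z hz) as [K [r [hK [hr h]]]].
exact (geom_bound_Cseries _ K r hr (h 0%nat)).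
Qed.

Lemma Cmod_mult_pow_lt_1 (z : C) (N : nat) :
  (Cmod z < 1)%R -> (Cmod (z * p ^ N) < 1)%R.
Proof.
intros hz; rewrite Cmod_mult, Cmod_pow.
assert (h : (Cmod p ^ N <= 1)%R).
{ rewrite <- (pow1 N); apply pow_incr; split; [apply Cmod_ge_0 | lra]. }
generalize (Cmod_ge_0 z) (pow_le _ N (Cmod_ge_0 p)); nra.
Qed.

(** With c_n the coefficient of z^n, c_n (1 - p^n) = c_(n-1) (1 - b p^(n-1)),
    so that the partial sums of the difference of the two sides telescope. *)
Lemma qbinom_rec (b z : C) : (Cmod z < 1)%R ->
  (1 - z) * Cseries (qbinom_term b z)
  = (1 - b * z) * Cseries (qbinom_term b (z * p)).
Proof.
intros hz.
assert (hzp := Cmod_mult_pow_lt_1 z 1 hz); rewrite Cpow_1_r in hzp.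
apply (series_telescope _ _
  (fun m => (-1) * (z * ((1 - b * p ^ m) * qbinom_term b z m)))
  _ _ _ _ (qbinom_Cseries b z hz) (qbinom_Cseries b (z * p) hzp)).
- destruct (qbinom_term_dominated b z hz) as [K [r [hK [hr h]]]].
  apply clim_scal_0, clim_scal_0.
  apply (clim_eq _ (1 * 0)); [ring | ]; apply clim_mult.
  + apply (clim_1_minus (fun m => b * p ^ m)); now apply clim_geom.
  + exact (geom_bound_clim_0 _ K r hr hK (h 0%nat)).
- assert (e : forall n, qbinom_term b (z * p) n = p ^ n * qbinom_term b z n).
  { intros n; unfold qbinom_term; rewrite Cpow_mult_l; ring. }
  induction m as [ | m IH].
  + rewrite 2!Csum_0; unfold qbinom_term; simpl; field; exact C1_nz.
  + rewrite 2!Csum_S, e.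
    replace ((1 - z) * (Csum (qbinom_term b z) m + qbinom_term b z (S m))
      - (1 - b * z) * (Csum (qbinom_term b (z * p)) m
                       + p ^ S m * qbinom_term b z (S m)))
    with (((1 - z) * Csum (qbinom_term b z) m
           - (1 - b * z) * Csum (qbinom_term b (z * p)) m)
      + ((1 - z) - (1 - b * z) * p ^ S m) * qbinom_term b z (S m)) by ring.
    rewrite IH, qbinom_term_S, Cpow_S; field; apply p_factor.
Qed.

Lemma qbinom_iter (b z : C) (N : nat) : (Cmod z < 1)%R ->
  qpoch z p N * Cseries (qbinom_term b z)
  = qpoch (b * z) p N * Cseries (qbinom_term b (z * p ^ N)).
Proof.
intros hz; induction N as [ | N IH].
- simpl; now rewrite (Cmult_1_r z).
- rewrite 2!qpoch_S.
  transitivity ((1 - z * p ^ N) * (qpoch z p N * Cseries (qbinom_term b z)));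
    [ring | rewrite IH].
  assert (e := qbinom_rec b _ (Cmod_mult_pow_lt_1 z N hz)).
  replace (z * p ^ N * p) with (z * p ^ S N) in e by (rewrite Cpow_S; ring).
  transitivity (qpoch (b * z) p N
    * ((1 - z * p ^ N) * Cseries (qbinom_term b (z * p ^ N)))); [ring | ].
  rewrite e; ring.
Qed.

(** Only the constant term survives as the argument tends to 0. *)
Lemma qbinom_lim (b z : C) : (Cmod z < 1)%R ->
  clim eventually (fun N => Cseries (qbinom_term b (z * p ^ N))) 1.
Proof.
intros hz.
set (v := fun n => match n with 0%nat => RtoC 1 | S _ => RtoC 0 end).
apply (tannery (fun N => qbinom_term b (z * p ^ N)) v).
- destruct (qbinom_term_dominated b z hz) as [K [r [hK [hr h]]]].
  exists K, r; split; [exact hK | split; [exact hr | ]].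
  intros N n; apply Rle_trans with (2 := h 0%nat n).
  unfold qbinom_term; rewrite 2!(Cmod_mult (_ / _)), 2!Cmod_pow.
  apply Rmult_le_compat_l; [apply Cmod_ge_0 | ].
  apply pow_incr; split; [apply Cmod_ge_0 | ].
  rewrite Cmod_mult, Cmod_pow.
  rewrite <- (Rmult_1_r (Cmod z)) at 2.
  apply Rmult_le_compat_l; [apply Cmod_ge_0 | ].
  rewrite <- (pow1 N); apply pow_incr; split; [apply Cmod_ge_0 | lra].
- intros [ | n].
  + apply (clim_ext (fun _ => 1)); [ | apply clim_const].
    intros N; unfold qbinom_term; simpl; field; exact C1_nz.
  + apply (clim_ext (fun N => qpoch b p (S n) / qpoch p p (S n)
             * ((z * p ^ N) ^ n * (z * p ^ N)))).
    { intros N; unfold qbinom_term; rewrite (Cpow_S _ n).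
      simpl v; unfold Cdiv; ring. }
    apply clim_scal_0.
    assert (h0 : clim eventually (fun N => z * p ^ N) 0)
      by now apply clim_geom.
    apply (clim_eq _ (0 ^ n * 0)); [simpl; ring | ].
    apply clim_mult; [now apply clim_pow | exact h0].
- intros N; now apply qbinom_Cseries, Cmod_mult_pow_lt_1.
- apply is_Cseries_clim; apply (clim_ext (fun _ => 1)); [ | apply clim_const].
  intros m; induction m as [ | m IH].
  + now rewrite Csum_0.
  + rewrite Csum_S, <- IH; simpl; ring.
Qed.

(** For [b = 0] the iterated relation reads (z;p)_N f(z) = f(z p^N), whose
    right-hand side tends to 1; hence f(z) is nonzero and (z;p)_N tends to
    its inverse. *)
Lemma qpoch_lim_lt_1 (z : C) : (Cmod z < 1)%R ->
  exists l : C, l <> 0 /\ clim eventually (qpoch z p) l.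
Proof.
intros hz; set (s := Cseries (qbinom_term 0 z)).
assert (hlim : clim eventually (fun N => qpoch z p N * s) 1).
{ apply (clim_ext (fun N => Cseries (qbinom_term 0 (z * p ^ N)))).
  - intros N; unfold s.
    now rewrite (qbinom_iter 0 z N hz), Cmult_0_l, qpoch_0_l, Cmult_1_l.
  - now apply qbinom_lim. }
assert (hs0 : s <> 0).
{ intros e; apply C1_nz.
  apply (clim_unique (fun N => qpoch z p N * s)); [exact hlim | ].
  apply (clim_ext (fun _ => 0)); [intros N; rewrite e; ring | ].
  apply clim_const. }
exists (/ s); split.
- intros e; apply C1_nz; rewrite <- (Cinv_r s hs0), e; ring.
- apply (clim_eq _ (1 * / s)); [ring | ].
  apply (clim_ext (fun N => qpoch z p N * s * / s)).
  + intros N; field; exact hs0.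
  + apply clim_mult; [exact hlim | apply clim_const].
Qed.

(** Splitting off finitely many factors reduces a general [x] to the case
    [Cmod x < 1]; only these factors can make the limit vanish. *)
Lemma qpoch_lim_factor (x : C) : exists (k : nat) (l : C), l <> 0 /\
  clim eventually (qpoch x p) (qpoch x p k * l).
Proof.
destruct (clim_geom x p hp 1 Rlt_0_1) as [k hk].
specialize (hk k (Nat.le_refl k)).
replace (x * p ^ k - 0) with (x * p ^ k) in hk by ring.
destruct (qpoch_lim_lt_1 _ hk) as [l [hl h]].
exists k, l; split; [exact hl | ].
apply (clim_incr_n _ _ k).
apply (clim_ext (fun n => qpoch x p k * qpoch (x * p ^ k) p n)).
- intros n; symmetry; apply qpoch_add.
- apply clim_mult; [apply clim_const | exact h].
Qed.

Lemma qpoch_inf_lim (x : C) : clim eventually (qpoch x p) (qpoch_inf x p).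
Proof.
destruct (qpoch_lim_factor x) as [k [l [_ h]]].
unfold qpoch_inf; now rewrite (CLim_seq_eq _ _ h).
Qed.

Lemma qpoch_inf_neq_0 (x : C) :
  (forall k, 1 - x * p ^ k <> 0) -> qpoch_inf x p <> 0.
Proof.
intros hx; destruct (qpoch_lim_factor x) as [k [l [hl h]]].
unfold qpoch_inf; rewrite (CLim_seq_eq _ _ h); apply Cmult_neq_0; [ | exact hl].
now apply qpoch_neq_0.
Qed.

Theorem qbinom_theorem (b z : C) : (Cmod z < 1)%R ->
  is_Cseries (qbinom_term b z) (qpoch_inf (b * z) p / qpoch_inf z p).
Proof.
intros hz.
assert (hz0 : qpoch_inf z p <> 0).
{ apply qpoch_inf_neq_0; intros k; apply Cmod_lt_1_factor; lra. }
assert (e : qpoch_inf z p * Cseries (qbinom_term b z)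
            = qpoch_inf (b * z) p * 1).
{ apply (clim_unique (fun N => qpoch z p N * Cseries (qbinom_term b z))).
  - apply clim_mult; [apply qpoch_inf_lim | apply clim_const].
  - apply (clim_ext (fun N =>
      qpoch (b * z) p N * Cseries (qbinom_term b (z * p ^ N)))).
    + intros N; symmetry; now apply qbinom_iter.
    + apply clim_mult; [apply qpoch_inf_lim | now apply qbinom_lim]. }
replace (qpoch_inf (b * z) p / qpoch_inf z p)
  with (Cseries (qbinom_term b z)); [now apply qbinom_Cseries | ].
rewrite Cmult_1_r in e; rewrite <- e; field; exact hz0.
Qed.

End Binomial.

(** * The very-well-poised series *)

Section Summation.

Variables q b : C.
Hypothesis hq0 : q <> 0.
Hypothesis hq1 : (Cmod q < 1)%R.
Hypothesis hb0 : b <> 0.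
Hypothesis hb1 : (Cmod (q ^ 2 / b) < 1)%R.

Local Notation z := (- (q ^ 2 / b)).

Let hz : (Cmod z < 1)%R.
Proof. now rewrite Cmod_opp. Qed.

Let hq2 : (Cmod (q ^ 2) < 1)%R.
Proof.
rewrite Cmod_pow; generalize (Cmod_ge_0 q); simpl; nra.
Qed.

Let q_factor (k : nat) : 1 - q * q ^ k <> 0.
Proof. apply Cmod_lt_1_factor; lra. Qed.

(** The general term of the series, with every pair of parameters c, -c
    merged into one symbol in base q^2. *)
Definition vwp_term (a : C) (n : nat) : C :=
  qpoch a q n * qpoch (a * q ^ 2) (q ^ 2) n * qpoch (a / q) (q ^ 2) n
  * qpoch b q n
  / (qpoch q q n * qpoch a (q ^ 2) n * qpoch (a * q ^ 3) (q ^ 2) n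
     * qpoch (a * q / b) q n) * z ^ n.

(** The denominators of [vwp_term] do not vanish. *)
Definition admissible (a : C) : Prop := forall k,
  1 - a * (q ^ 2) ^ k <> 0 /\ 1 - a * q ^ 3 * (q ^ 2) ^ k <> 0 /\
  1 - a * q / b * q ^ k <> 0.

Lemma admissible_shift (a : C) : admissible a -> admissible (a * q ^ 2).
Proof.
intros h k; destruct (h (S k)) as [h1 [h2 _]].
destruct (h (S (S k))) as [_ [_ h3]].
split; [ | split].
- intros e; apply h1; rewrite <- e, (Cpow_S (q ^ 2)); ring.
- intros e; apply h2; rewrite <- e, (Cpow_S (q ^ 2)); ring.
- intros e; apply h3; rewrite <- e, (Cpow_S q (S k)), (Cpow_S q k); field; exact hb0.
Qed.

Lemma admissible_iter (a : C) (N : nat) :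
  admissible a -> admissible (a * (q ^ 2) ^ N).
Proof.
intros h; induction N as [ | N IH].
- now replace (a * (q ^ 2) ^ 0) with a by (simpl; ring).
- replace (a * (q ^ 2) ^ S N) with (a * (q ^ 2) ^ N * q ^ 2)
    by (rewrite (Cpow_S (q ^ 2)); ring).
  now apply admissible_shift.
Qed.

Lemma Cpow_sqr (n : nat) : (q ^ 2) ^ n = (q ^ n) ^ 2.
Proof. now rewrite <- 2!Cpow_mult_r, Nat.mul_comm. Qed.

Definition vwp_ratio (a : C) (n : nat) : C :=
  z * (1 - a * q ^ n) * (1 - a * q ^ 2 * (q ^ 2) ^ n)
  * (1 - a / q * (q ^ 2) ^ n) * (1 - b * q ^ n)
  * / ((1 - q * q ^ n) * (1 - a * (q ^ 2) ^ n)
       * (1 - a * q ^ 3 * (q ^ 2) ^ n) * (1 - a * q / b * q ^ n)).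

Lemma vwp_term_S (a : C) (n : nat) : admissible a ->
  vwp_term a (S n) = vwp_ratio a n * vwp_term a n.
Proof.
intros h; unfold vwp_term, vwp_ratio.
assert (h1 := qpoch_neq_0 q q n q_factor).
assert (h2 := qpoch_neq_0 a (q ^ 2) n (fun k => proj1 (h k))).
assert (h3 := qpoch_neq_0 (a * q ^ 3) (q ^ 2) n
                (fun k => proj1 (proj2 (h k)))).
assert (h4 := qpoch_neq_0 (a * q / b) q n (fun k => proj2 (proj2 (h k)))).
destruct (h n) as [k1 [k2 k3]]; assert (k4 := q_factor n).
rewrite 8!qpoch_S, (Cpow_S z).
revert h1 h2 h3 h4 k1 k2 k3 k4.
generalize (qpoch q q n) (qpoch a (q ^ 2) n) (qpoch (a * q ^ 3) (q ^ 2) n)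
  (qpoch (a * q / b) q n) (qpoch a q n) (qpoch (a * q ^ 2) (q ^ 2) n)
  (qpoch (a / q) (q ^ 2) n) (qpoch b q n) z (z ^ n).
intros A1 A2 A3 A4 A5 A6 A7 A8 A9 A10.
generalize (1 - a * (q ^ 2) ^ n) (1 - a * q ^ 3 * (q ^ 2) ^ n)
  (1 - a * q / b * q ^ n) (1 - q * q ^ n) (1 - a * q ^ n)
  (1 - a * q ^ 2 * (q ^ 2) ^ n) (1 - a / q * (q ^ 2) ^ n) (1 - b * q ^ n).
intros B1 B2 B3 B4 B5 B6 B7 B8; intros; field; repeat split; assumption.
Qed.

(** Every symbol containing [x N] tends to 1. *)
Lemma vwp_term_lim (x : nat -> C) (n : nat) : clim eventually x 0 ->
  clim eventually (fun N => vwp_term (x N) n) (qbinom_term q b z n).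
Proof.
intros hx; unfold vwp_term, qbinom_term.
assert (hc : forall c p, clim eventually (fun N => qpoch (x N * c) p n) 1).
{ intros c p; apply clim_qpoch.
  apply (clim_ext (fun N => c * x N)); [intros N; ring | ].
  now apply clim_scal_0. }
apply (clim_ext (fun N => qpoch (x N * 1) q n * qpoch (x N * q ^ 2) (q ^ 2) n
  * qpoch (x N * / q) (q ^ 2) n * qpoch b q n
  * / (qpoch q q n * qpoch (x N * 1) (q ^ 2) n
       * qpoch (x N * q ^ 3) (q ^ 2) n * qpoch (x N * (q / b)) q n) * z ^ n)).
{ intros N; rewrite Cmult_1_r.
  now replace (x N * (q / b)) with (x N * q / b) by (unfold Cdiv; ring). }
assert (h1 := qpoch_neq_0 q q n q_factor).
apply (clim_eq _ (1 * 1 * 1 * qpoch b q n * / (qpoch q q n * 1 * 1 * 1)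
                  * z ^ n)).
{ rewrite !Cmult_1_r, !Cmult_1_l; reflexivity. }
apply clim_mult; [ | apply clim_const].
apply clim_mult.
- repeat apply clim_mult; try apply hc; apply clim_const.
- apply clim_inv; [now rewrite !Cmult_1_r | ].
  repeat apply clim_mult; try apply hc; apply clim_const.
Qed.

(** Each factor of the ratio has the form 1 - y with |y| <= K r^n, where K
    does not depend on [N] because |q^(2N)| <= 1. *)
Lemma vwp_dominated (a : C) : admissible a ->
  geom_dominated (fun N => vwp_term (a * (q ^ 2) ^ N)).
Proof.
intros h.
apply (ratio_geom_dominated _ (qbinom_term q b z)
  (fun t => vwp_ratio (a * (q ^ 2) ^ fst t) (snd t)) z hz).
- assert (h1 : forall c, clim uniformly (fun t => 1 - c * q ^ snd t) 1).
  { intros c; apply (clim_1_minus (fun t => c * q ^ snd t)).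
    apply (clim_uniformly_geom _ (Cmod c) (Cmod q)).
    - apply Cmod_ge_0.
    - split; [apply Cmod_ge_0 | exact hq1].
    - intros N n; simpl; rewrite Cmod_mult, Cmod_pow; lra. }
  assert (h2 : forall c p, (Cmod p < 1)%R -> clim uniformly
            (fun t => 1 - a * (q ^ 2) ^ fst t * c * p ^ snd t) 1).
  { intros c p hp.
    apply (clim_1_minus (fun t => a * (q ^ 2) ^ fst t * c * p ^ snd t)).
    apply (clim_uniformly_geom _ (Cmod (a * c)) (Cmod p)).
    - apply Cmod_ge_0.
    - split; [apply Cmod_ge_0 | exact hp].
    - intros N n; simpl fst; simpl snd.
      replace (a * (q ^ 2) ^ N * c * p ^ n)
        with (a * c * p ^ n * (q ^ 2) ^ N) by ring.
      rewrite Cmod_mult, (Cmod_mult (a * c)), (Cmod_pow p), (Cmod_pow (q ^ 2)).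
      rewrite <- (Rmult_1_r (Cmod (a * c) * Cmod p ^ n)) at 2.
      apply Rmult_le_compat_l.
      + apply Rmult_le_pos; [apply Cmod_ge_0 | apply pow_le, Cmod_ge_0].
      + rewrite <- (pow1 N); apply pow_incr; split; [apply Cmod_ge_0 | lra]. }
  assert (h3 : forall p, (Cmod p < 1)%R -> clim uniformly
            (fun t => 1 - a * (q ^ 2) ^ fst t * p ^ snd t) 1).
  { intros p hp; apply (clim_ext
      (fun t => 1 - a * (q ^ 2) ^ fst t * 1 * p ^ snd t)); auto.
    intros t; now rewrite Cmult_1_r. }
  apply (clim_eq _ (z * 1 * 1 * 1 * 1 * / (1 * 1 * 1 * 1))).
  { field; exact hb0. }
  unfold vwp_ratio.
  apply clim_mult; [ | apply clim_inv; [rewrite !Cmult_1_r; exact C1_nz | ]].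
  + repeat apply clim_mult; auto; [apply clim_const | now apply h2].
  + repeat apply clim_mult; auto.
    apply (clim_ext
      (fun t => 1 - a * (q ^ 2) ^ fst t * (q / b) * q ^ snd t)); auto.
    intros t; unfold Cdiv; ring.
- intros N n; now apply vwp_term_S, admissible_iter.
- intros n; now apply vwp_term_lim, clim_geom.
Qed.

Lemma vwp_Cseries (a : C) : admissible a ->
  is_Cseries (vwp_term a) (Cseries (vwp_term a)).
Proof.
intros h; destruct (vwp_dominated a h) as [K [r [hK [hr hb]]]].
apply (geom_bound_Cseries _ K r hr); intros n.
generalize (hb 0%nat n); simpl; now rewrite Cmult_1_r.
Qed.

Lemma vwp_Cseries_lim (a : C) : admissible a ->
  clim eventually (fun N => Cseries (vwp_term (a * (q ^ 2) ^ N)))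
    (qpoch_inf (- q ^ 2) q / qpoch_inf z q).
Proof.
intros h.
apply (tannery (fun N => vwp_term (a * (q ^ 2) ^ N)) (qbinom_term q b z)).
- now apply vwp_dominated.
- intros n; now apply vwp_term_lim, clim_geom.
- intros N; now apply vwp_Cseries, admissible_iter.
- replace (- q ^ 2) with (b * z) by (field; exact hb0).
  now apply qbinom_theorem.
Qed.

(** * The contiguous relation *)

(** The numerator found by Gosper's algorithm.  Dividing the
    partial sums of the contiguous relation by a hypergeometric term leaves a
    polynomial of degree 2 in x = q^(m+1), determined by its constant and
    leading coefficients and its value at x = q. *)
Definition cert_poly (a x : C) : C :=
  a / q * ((1 - q ^ 2 / b) * (1 - a * x ^ 2) + (1 - q) * (1 - a * q / b) * x).

(** The symbols common to both sides of the contiguous relation.  The one in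
    base q^2 in the numerator starts at aq rather than at a/q, the first factor
    of (a/q;q^2)_(m+1) being split off: this keeps the closed form valid for
    a = q and a = 1/q, where 1 - a/q or 1 - aq vanishes. *)
Definition cert_base (a : C) (m : nat) : C :=
  qpoch (a * q) q m * qpoch b q m * qpoch (a * q) (q ^ 2) m
  * / (qpoch q q m * qpoch (a * q ^ 3 / b) q m * qpoch (a * q ^ 5) (q ^ 2) m)
  * z ^ m.

Definition cert (a : C) (m : nat) : C :=
  z * (1 - b * q ^ m) * cert_poly a (q ^ S m) * cert_base a m.

Lemma cert_factors (a : C) (k : nat) : admissible a ->
  1 - a * q ^ 3 / b * q ^ k <> 0 /\ 1 - a * q ^ 5 * (q ^ 2) ^ k <> 0.
Proof.
intros h; apply admissible_shift in h.
destruct (h k) as [_ [h1 h2]]; split.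
- intros e; apply h2; rewrite <- e; field; exact hb0.
- intros e; apply h1; rewrite <- e; ring.
Qed.

(** All symbols converge and the limits of those in the denominator are
    nonzero, so the power of z forces the limit 0. *)
Lemma cert_lim (a : C) : admissible a -> clim eventually (cert a) 0.
Proof.
intros h.
assert (hc : forall k, 1 - a * q ^ 3 / b * q ^ k <> 0)
  by (intros k; now apply cert_factors).
assert (hd : forall k, 1 - a * q ^ 5 * (q ^ 2) ^ k <> 0)
  by (intros k; now apply cert_factors).
assert (hbase : clim eventually (cert_base a) 0).
{ unfold cert_base.
  set (l := qpoch_inf (a * q) q * qpoch_inf b q * qpoch_inf (a * q) (q ^ 2)
    * / (qpoch_inf q q * qpoch_inf (a * q ^ 3 / b) q
         * qpoch_inf (a * q ^ 5) (q ^ 2))).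
  apply (clim_eq _ (l * 0)); [ring | ].
  apply clim_mult.
  - apply clim_mult; [ | apply clim_inv].
    + repeat apply clim_mult; now apply qpoch_inf_lim.
    + repeat apply Cmult_neq_0; now apply qpoch_inf_neq_0.
    + repeat apply clim_mult; now apply qpoch_inf_lim.
  - apply (clim_ext (fun m => 1 * z ^ m)); [intros m; ring | ].
    now apply clim_geom. }
assert (hx : clim eventually (fun m => q ^ S m) 0)
  by (apply (clim_ext (fun m => q * q ^ m)); [reflexivity | now apply clim_geom]).
assert (hpoly : exists l, clim eventually (fun m => cert_poly a (q ^ S m)) l).
{ unfold cert_poly; eexists.
  apply clim_mult; [apply clim_const | apply clim_plus].
  - apply clim_mult; [apply clim_const | ].
    apply (clim_1_minus (fun m => a * (q ^ S m) ^ 2)).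
    apply clim_scal_0.
    apply (clim_eq _ (0 ^ 2)); [simpl; ring | now apply clim_pow].
  - apply clim_mult; [apply clim_const | exact hx]. }
destruct hpoly as [l hl]; unfold cert.
apply (clim_eq _ (z * 1 * l * 0)); [ring | ].
apply clim_mult; [apply clim_mult; [apply clim_mult | ] | ].
- apply clim_const.
- apply (clim_1_minus (fun m => b * q ^ m)); now apply clim_geom.
- exact hl.
- exact hbase.
Qed.

Local Notation lcoef a := ((1 - a * q ^ 3) * (1 - a * q / b) * (1 - a * q ^ 2 / b)).
Local Notation rcoef a := ((1 - a * q) * (1 - a * q ^ 2) * (1 - a * q ^ 3 / b ^ 2)).

Lemma vwp_term_cert_l (a : C) (m : nat) : admissible a ->
  lcoef a * vwp_term a (S m)
  = (1 - a * q ^ 2 * (q ^ m) ^ 2) * (1 - a / q) * (1 - b * q ^ m) * z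
    * (1 - a * q ^ 2 / b * q ^ m) * / (1 - q * q ^ m) * cert_base a m.
Proof.
intros h; unfold vwp_term, cert_base.
assert (n1 := qpoch_neq_0 q q m q_factor).
assert (n2 := qpoch_neq_0 (a * q ^ 3 / b) q m
                (fun k => proj1 (cert_factors a k h))).
assert (n3 := qpoch_neq_0 (a * q ^ 5) (q ^ 2) m
                (fun k => proj2 (cert_factors a k h))).
assert (n4 : qpoch (a * q ^ 2) (q ^ 2) m <> 0).
{ apply qpoch_neq_0; intros k; exact (proj1 (admissible_shift a h k)). }
destruct (h 0%nat) as [k1 [k2 k3]]; change ((q ^ 2) ^ 0) with (RtoC 1) in k1, k2.
change (q ^ 0) with (RtoC 1) in k3.
rewrite ?Cmult_1_r in k1, k2, k3.
destruct (h 1%nat) as [_ [_ k4]]; rewrite Cpow_1_r in k4.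
destruct (h (S m)) as [_ [_ k5]]; assert (k6 := q_factor m).
replace (a * q / b * q) with (a * q ^ 2 / b) in k4 by (field; exact hb0).
replace (a * q / b * q ^ S m) with (a * q ^ 2 / b * q ^ m) in k5
  by (rewrite (Cpow_S q m); field; exact hb0).
assert (e1 : qpoch (a * q ^ 2 / b) q m
  = (1 - a * q ^ 2 / b) * qpoch (a * q ^ 3 / b) q m
    / (1 - a * q ^ 2 / b * q ^ m)).
{ assert (e := qpoch_S_l (a * q ^ 2 / b) q m); rewrite qpoch_S in e.
  replace (a * q ^ 2 / b * q) with (a * q ^ 3 / b) in e
    by (field; exact hb0).
  rewrite <- e; revert k5; generalize (1 - a * q ^ 2 / b * q ^ m).
  intros B k5; field; exact k5. }
rewrite (qpoch_S_l a q), (qpoch_S (a * q ^ 2) (q ^ 2)),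
  (qpoch_S_l (a / q) (q ^ 2)), (qpoch_S b q), (qpoch_S q q),
  (qpoch_S_l a (q ^ 2)), (qpoch_S_l (a * q ^ 3) (q ^ 2)),
  (qpoch_S_l (a * q / b) q), (Cpow_S z), Cpow_sqr.
replace (a / q * q ^ 2) with (a * q) by (field; exact hq0).
replace (a * q ^ 3 * q ^ 2) with (a * q ^ 5) by ring.
replace (a * q / b * q) with (a * q ^ 2 / b) by (field; exact hb0).
rewrite e1; clear e1.
revert n1 n2 n3 n4 k1 k2 k3 k4 k5 k6.
generalize (qpoch q q m) (qpoch (a * q ^ 3 / b) q m)
  (qpoch (a * q ^ 5) (q ^ 2) m) (qpoch (a * q ^ 2) (q ^ 2) m)
  (qpoch (a * q) q m) (qpoch b q m) (qpoch (a * q) (q ^ 2) m) z (z ^ m).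
intros A1 A2 A3 A4 A5 A6 A7 A8 A9.
generalize (1 - a) (1 - a * q ^ 3) (1 - a * q / b) (1 - a * q ^ 2 / b)
  (1 - a * q ^ 2 / b * q ^ m) (1 - q * q ^ m)
  (1 - a * q ^ 2 * (q ^ m) ^ 2) (1 - a / q) (1 - b * q ^ m).
intros B1 B2 B3 B4 B5 B6 B7 B8 B9; intros; field; repeat split; assumption.
Qed.

Lemma vwp_term_cert_r (a : C) (m : nat) : admissible a ->
  rcoef a * vwp_term (a * q ^ 2) (S m)
  = (1 - a * q ^ 3 / b ^ 2) * (1 - a * q * q ^ m) * (1 - a * q ^ 2 * q ^ m)
    * (1 - a * q ^ 4 * (q ^ m) ^ 2) * (1 - a * q * (q ^ m) ^ 2)
    * (1 - b * q ^ m) * z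
    * / ((1 - q * q ^ m) * (1 - a * q ^ 5 * (q ^ m) ^ 2)
         * (1 - a * q ^ 3 / b * q ^ m)) * cert_base a m.
Proof.
intros h; unfold vwp_term, cert_base.
assert (n1 := qpoch_neq_0 q q m q_factor).
assert (n2 := qpoch_neq_0 (a * q ^ 3 / b) q m
                (fun k => proj1 (cert_factors a k h))).
assert (n3 := qpoch_neq_0 (a * q ^ 5) (q ^ 2) m
                (fun k => proj2 (cert_factors a k h))).
assert (h' := admissible_shift _ (admissible_shift _ h)).
assert (n4 : qpoch (a * q ^ 4) (q ^ 2) m <> 0).
{ apply qpoch_neq_0; intros k; generalize (proj1 (h' k)).
  now replace (a * q ^ 2 * q ^ 2) with (a * q ^ 4) by ring. }
destruct (cert_factors a m h) as [k1 k2].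
destruct (h 1%nat) as [k3 _]; rewrite Cpow_1_r in k3.
assert (k4 := q_factor m).
rewrite Cpow_sqr in k2.
replace (a * q ^ 2 * q ^ 2) with (a * q ^ 4) by ring.
replace (a * q ^ 2 / q) with (a * q) by (field; exact hq0).
replace (a * q ^ 2 * q ^ 3) with (a * q ^ 5) by ring.
replace (a * q ^ 2 * q / b) with (a * q ^ 3 / b) by (field; exact hb0).
(* The factor 1 - aq stays on the left, since it may vanish. *)
assert (e1 : (1 - a * q) * qpoch (a * q ^ 2) q (S m)
  = qpoch (a * q) q m * (1 - a * q * q ^ m) * (1 - a * q ^ 2 * q ^ m)).
{ replace (a * q ^ 2) with (a * q * q) at 1 by ring.
  rewrite <- qpoch_S_l, 2!qpoch_S, (Cpow_S q m); ring. }
rewrite (qpoch_S (a * q ^ 4) (q ^ 2)), (qpoch_S (a * q) (q ^ 2)), (qpoch_S b q),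
  (qpoch_S q q), (qpoch_S_l (a * q ^ 2) (q ^ 2)), (qpoch_S (a * q ^ 5) (q ^ 2)),
  (qpoch_S (a * q ^ 3 / b) q), (Cpow_S z), Cpow_sqr.
replace (a * q ^ 2 * q ^ 2) with (a * q ^ 4) by ring.
revert n1 n2 n3 n4 k1 k2 k3 k4 e1.
generalize (qpoch q q m) (qpoch (a * q ^ 3 / b) q m)
  (qpoch (a * q ^ 5) (q ^ 2) m) (qpoch (a * q ^ 4) (q ^ 2) m)
  (qpoch (a * q) q m) (qpoch b q m) (qpoch (a * q) (q ^ 2) m) z (z ^ m)
  (qpoch (a * q ^ 2) q (S m)).
intros A1 A2 A3 A4 A5 A6 A7 A8 A9 A10.
generalize (1 - a * q) (1 - a * q ^ 2) (1 - a * q ^ 3 / b ^ 2)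
  (1 - a * q ^ 3 / b * q ^ m) (1 - a * q ^ 5 * (q ^ m) ^ 2) (1 - q * q ^ m)
  (1 - a * q * q ^ m) (1 - a * q ^ 2 * q ^ m) (1 - a * q ^ 4 * (q ^ m) ^ 2)
  (1 - a * q * (q ^ m) ^ 2) (1 - b * q ^ m).
intros B1 B2 B3 B4 B5 B6 B7 B8 B9 B10 B11.
intros n1 n2 n3 n4 k1 k2 k3 k4 e1.
transitivity ((B1 * A10) * (B2 * B3
  * (A4 * B9 * (A7 * B10) * (A6 * B11)
     / (A1 * B6 * (B2 * A4) * (A3 * B5) * (A2 * B4)) * (A8 * A9)))).
- unfold Cdiv; ring.
- rewrite e1; field; repeat split; assumption.
Qed.

Lemma cert_base_S (a : C) (m : nat) : admissible a ->
  cert_base a (S m)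
  = (1 - a * q * q ^ m) * (1 - b * q ^ m) * (1 - a * q * (q ^ m) ^ 2) * z
    * / ((1 - q * q ^ m) * (1 - a * q ^ 3 / b * q ^ m)
         * (1 - a * q ^ 5 * (q ^ m) ^ 2)) * cert_base a m.
Proof.
intros h; unfold cert_base.
assert (n1 := qpoch_neq_0 q q m q_factor).
assert (n2 := qpoch_neq_0 (a * q ^ 3 / b) q m
                (fun k => proj1 (cert_factors a k h))).
assert (n3 := qpoch_neq_0 (a * q ^ 5) (q ^ 2) m
                (fun k => proj2 (cert_factors a k h))).
destruct (cert_factors a m h) as [k1 k2].
assert (k3 := q_factor m).
rewrite 6!qpoch_S, (Cpow_S z); rewrite Cpow_sqr in *.
revert n1 n2 n3 k1 k2 k3.
generalize (qpoch q q m) (qpoch (a * q ^ 3 / b) q m)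
  (qpoch (a * q ^ 5) (q ^ 2) m)
  (qpoch (a * q) q m) (qpoch b q m) (qpoch (a * q) (q ^ 2) m) z (z ^ m).
intros A1 A2 A3 A4 A5 A6 A7 A8.
generalize (1 - a * q ^ 3 / b * q ^ m) (1 - a * q ^ 5 * (q ^ m) ^ 2)
  (1 - q * q ^ m) (1 - a * q * q ^ m) (1 - b * q ^ m)
  (1 - a * q * (q ^ m) ^ 2).
intros B1 B2 B3 B4 B5 B6; intros; field; repeat split; assumption.
Qed.

(** After division by the common base this is an identity between rational
    functions of a, b, q and x = q^m. *)
Lemma cert_step (a : C) (m : nat) : admissible a ->
  cert a (S m)
  = cert a m + lcoef a * vwp_term a (S m)
    - rcoef a * vwp_term (a * q ^ 2) (S m).
Proof.
intros h.
rewrite (vwp_term_cert_l a m h), (vwp_term_cert_r a m h).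
unfold cert; rewrite (cert_base_S a m h).
destruct (cert_factors a m h) as [k1 k2]; rewrite Cpow_sqr in k2.
assert (k3 := q_factor m).
unfold cert_poly; rewrite (Cpow_S q (S m)), (Cpow_S q m).
generalize (cert_base a m); intros E.
revert k1 k2 k3; generalize (q ^ m); intros x k1 k2 k3.
(* The form in which the field tactic meets this denominator. *)
assert (k1' : b - a * q ^ 3 * x <> 0).
{ intros e; apply k1.
  replace (1 - a * q ^ 3 / b * x) with ((b - a * q ^ 3 * x) / b)
    by (field; exact hb0).
  rewrite e; unfold Cdiv; ring. }
field; repeat split; assumption.
Qed.

Lemma cert_sum (a : C) (m : nat) : admissible a ->
  lcoef a * Csum (vwp_term a) m - rcoef a * Csum (vwp_term (a * q ^ 2)) m
  = cert a m.
Proof.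
intros h; induction m as [ | m IH].
- rewrite 2!Csum_0; unfold vwp_term, cert, cert_poly, cert_base; simpl.
  field; repeat split; auto; exact C1_nz.
- rewrite 2!Csum_S, (cert_step a m h), <- IH; ring.
Qed.

Lemma vwp_rec (a : C) : admissible a ->
  lcoef a * Cseries (vwp_term a) = rcoef a * Cseries (vwp_term (a * q ^ 2)).
Proof.
intros h.
apply (series_telescope (vwp_term a) (vwp_term (a * q ^ 2)) (cert a)).
- now apply vwp_Cseries.
- now apply vwp_Cseries, admissible_shift.
- now apply cert_lim.
- intros m; now apply cert_sum.
Qed.

(** The induction applies the hypothesis to a q^2 rather than
    extending the product at its far end: the factor to cancel is then
    1 - aq^3, which admissibility makes nonzero, and not 1 - aq. *)
Lemma vwp_iter (N : nat) : forall a : C, admissible a ->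
  (1 - a * q * (q ^ 2) ^ N) * qpoch (a * q / b) q (2 * N)
  * Cseries (vwp_term a)
  = (1 - a * q) * qpoch (a * q ^ 2) (q ^ 2) N
    * qpoch (a * q ^ 3 / b ^ 2) (q ^ 2) N
    * Cseries (vwp_term (a * (q ^ 2) ^ N)).
Proof.
induction N as [ | N IH]; intros a h.
- simpl; rewrite !Cmult_1_r; reflexivity.
- assert (e := IH _ (admissible_shift a h)); clear IH.
  assert (r := vwp_rec a h).
  assert (h3 : 1 - a * q ^ 3 <> 0).
  { destruct (h 0%nat) as [_ [h3 _]]; change ((q ^ 2) ^ 0) with (RtoC 1) in h3.
    now rewrite Cmult_1_r in h3. }
  (* Expanding at the near end matches the products for a q^2. *)
  replace (2 * S N)%nat with (S (S (2 * N))) by lia.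
  rewrite (qpoch_S_l (a * q / b)), (qpoch_S_l (a * q / b * q)),
    (qpoch_S_l (a * q ^ 2)), (qpoch_S_l (a * q ^ 3 / b ^ 2)).
  replace (a * q / b * q) with (a * q ^ 2 / b) by (field; exact hb0).
  replace (a * q ^ 2 / b * q) with (a * q ^ 3 / b) by (field; exact hb0).
  replace (a * (q ^ 2) ^ S N) with (a * q ^ 2 * (q ^ 2) ^ N)
    by (rewrite (Cpow_S (q ^ 2)); ring).
  replace (a * q * (q ^ 2) ^ S N) with (a * q ^ 2 * q * (q ^ 2) ^ N)
    by (rewrite (Cpow_S (q ^ 2)); ring).
  replace (a * q ^ 2 * q / b) with (a * q ^ 3 / b) in e
    by (field; exact hb0).
  replace (a * q ^ 2 * q ^ 3 / b ^ 2) with (a * q ^ 3 / b ^ 2 * q ^ 2) in e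
    by (field; exact hb0).
  replace (1 - a * q ^ 2 * q) with (1 - a * q ^ 3) in e by ring.
  revert e r h3.
  generalize (Cseries (vwp_term a)) (Cseries (vwp_term (a * q ^ 2)))
    (Cseries (vwp_term (a * q ^ 2 * (q ^ 2) ^ N)))
    (qpoch (a * q ^ 3 / b) q (2 * N)) (qpoch (a * q ^ 2 * q ^ 2) (q ^ 2) N)
    (qpoch (a * q ^ 3 / b ^ 2 * q ^ 2) (q ^ 2) N).
  intros s s1 sN A1 A2 A3.
  generalize (1 - a * q ^ 3) (1 - a * q / b) (1 - a * q ^ 2 / b) (1 - a * q)
    (1 - a * q ^ 2) (1 - a * q ^ 3 / b ^ 2)
    (1 - a * q ^ 2 * q * (q ^ 2) ^ N).
  intros B1 B2 B3 B4 B5 B6 B7 e r h3.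
  assert (c : B1 * (B7 * (B2 * (B3 * A1)) * s)
              = B1 * (B4 * (B5 * A2) * (B6 * A3) * sN)).
  { transitivity (B7 * A1 * (B1 * B2 * B3 * s)); [ring | rewrite r].
    transitivity (B4 * B5 * B6 * (B7 * A1 * s1)); [ring | rewrite e; ring]. }
  apply (f_equal (Cmult (/ B1))) in c.
  rewrite 2!(Cmult_assoc (/ B1) B1), (Cinv_l B1 h3), 2!Cmult_1_l in c.
  exact c.
Qed.

Theorem vwp_sum (a : C) : admissible a ->
  is_Cseries (vwp_term a)
    ((1 - a * q)
     * (qpoch_inf (- q ^ 2) q / (qpoch_inf z q * qpoch_inf (a * q / b) q))
     * qpoch_inf (a * q ^ 2) (q ^ 2)
     * qpoch_inf (a * q ^ 3 / b ^ 2) (q ^ 2)).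
Proof.
intros h.
assert (n1 : qpoch_inf z q <> 0).
{ apply qpoch_inf_neq_0; [exact hq1 | intros k].
  apply Cmod_lt_1_factor; [exact hz | lra]. }
assert (n2 : qpoch_inf (a * q / b) q <> 0).
{ apply qpoch_inf_neq_0; [exact hq1 | intros k].
  exact (proj2 (proj2 (h k))). }
assert (e : 1 * qpoch_inf (a * q / b) q * Cseries (vwp_term a)
  = (1 - a * q) * qpoch_inf (a * q ^ 2) (q ^ 2)
    * qpoch_inf (a * q ^ 3 / b ^ 2) (q ^ 2)
    * (qpoch_inf (- q ^ 2) q / qpoch_inf z q)).
{ apply (clim_unique (fun N => (1 - a * q * (q ^ 2) ^ N)
    * qpoch (a * q / b) q (2 * N) * Cseries (vwp_term a))).
  - apply clim_mult; [apply clim_mult | apply clim_const].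
    + apply (clim_1_minus (fun N => a * q * (q ^ 2) ^ N)).
      now apply clim_geom.
    + apply (clim_subseq (qpoch (a * q / b) q)); [intros n; lia | ].
      now apply qpoch_inf_lim.
  - apply (clim_ext (fun N => (1 - a * q) * qpoch (a * q ^ 2) (q ^ 2) N
      * qpoch (a * q ^ 3 / b ^ 2) (q ^ 2) N
      * Cseries (vwp_term (a * (q ^ 2) ^ N)))).
    + intros N; symmetry; now apply vwp_iter.
    + apply clim_mult; [ | now apply vwp_Cseries_lim].
      apply clim_mult; [ | now apply qpoch_inf_lim].
      apply clim_mult; [apply clim_const | now apply qpoch_inf_lim]. }
match goal with |- is_series _ ?v => replace v with (Cseries (vwp_term a)) end.
{ now apply vwp_Cseries. }
rewrite Cmult_1_l in e.
transitivity (/ qpoch_inf (a * q / b) q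
  * (qpoch_inf (a * q / b) q * Cseries (vwp_term a))).
- rewrite Cmult_assoc, Cinv_l, Cmult_1_l; [reflexivity | exact n2].
- rewrite e; revert n1 n2.
  generalize (qpoch_inf z q) (qpoch_inf (a * q / b) q) (1 - a * q)
    (qpoch_inf (a * q ^ 2) (q ^ 2)) (qpoch_inf (a * q ^ 3 / b ^ 2) (q ^ 2))
    (qpoch_inf (- q ^ 2) q).
  intros A1 A2 A3 A4 A5 A6 n1 n2; field; now split.
Qed.

End Summation.

Theorem theorem4 (q a b sa sq : C)
  (hq0 : q <> 0) (hq1 : (Cmod q < 1)%R)
  (hb0 : b <> 0) (hb1 : (Cmod (q ^ 2 / b) < 1)%R)
  (hsa : sa ^ 2 = a) (hsq : sq ^ 2 = q)
  (hden : forall k : nat,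
     sa <> / q ^ k /\
     - sa <> / q ^ k /\
     sa * sq ^ 3 <> / q ^ k /\
     - (sa * sq ^ 3) <> / q ^ k /\
     a * q / b <> / q ^ k) :
  is_phi
    [a; sa * q; - (sa * q); sa * / sq; - (sa * / sq); b]
    [sa; - sa; sa * sq ^ 3; - (sa * sq ^ 3); a * q / b]
    q (- (q ^ 2 / b))
    ((1 - a * q)
     * (qpoch_inf (- q ^ 2) q
        / (qpoch_inf (- (q ^ 2 / b)) q * qpoch_inf (a * q / b) q))
     * qpoch_inf (a * q ^ 2) (q ^ 2)
     * qpoch_inf (a * q ^ 3 / b ^ 2) (q ^ 2)).
Proof.
assert (hsq0 : sq <> 0).
{ intros e; apply hq0; rewrite <- hsq, e; simpl; ring. }
assert (hfac : forall (x : C) (k : nat), x <> / q ^ k -> 1 - x * q ^ k <> 0).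
{ intros x k hx e; apply hx.
  assert (hk := Cpow_nz q k hq0).
  assert (e' : x * q ^ k = 1)
    by (replace (x * q ^ k) with (1 - (1 - x * q ^ k)) by ring;
        rewrite e; ring).
  rewrite <- (Cmult_1_l (/ q ^ k)), <- e'; field; exact hk. }
assert (hsq_fac : forall (x : C) (k : nat), x <> / q ^ k -> - x <> / q ^ k ->
  1 - x ^ 2 * (q ^ 2) ^ k <> 0).
{ intros x k h1 h2; rewrite Cpow_sqr.
  replace (1 - x ^ 2 * (q ^ k) ^ 2)
    with ((1 - x * q ^ k) * (1 - - x * q ^ k)) by ring.
  apply Cmult_neq_0; now apply hfac. }
assert (e3 : (sa * sq ^ 3) ^ 2 = a * q ^ 3) by (rewrite <- hsa, <- hsq; ring).
assert (hadm : admissible q b a).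
{ intros k; destruct (hden k) as [h1 [h2 [h3 [h4 h5]]]].
  split; [ | split].
  - rewrite <- hsa; now apply hsq_fac.
  - rewrite <- e3; now apply hsq_fac.
  - now apply hfac. }
unfold is_phi.
apply (is_series_ext (K := C_AbsRing) (V := C_NormedModule) (vwp_term q b a)).
2: now apply vwp_sum.
intros n; unfold phi_term, vwp_term, qpochs; cbn [map fold_right].
replace (a * q ^ 2) with ((sa * q) ^ 2) by (rewrite <- hsa; ring).
replace (a / q) with ((sa * / sq) ^ 2)
  by (rewrite <- hsa, <- hsq; field; exact hsq0).
rewrite <- e3.
replace (qpoch a (q ^ 2) n) with (qpoch (sa ^ 2) (q ^ 2) n) by now rewrite hsa.
rewrite <- 4!qpoch_opp, !Cmult_1_r, !Cmult_assoc; reflexivity.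
Qed.
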